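(* For every integer $k\ge 1$ there is a constant $c_k$ such that for every graph $G$ with $m$ edges and no isolated vertices, \[ r_{k+1}(K_3;G)\le c_k\, m^{\frac{k+1}{2}}. \]
   Context: For a graph $G$ and integer $k\ge1$, the multicolor Ramsey number $r_{k+1}(K_3;G)$ is the least positive integer $N$ such that every coloring of the edges of the complete graph $K_N$ with colors $1,\dots,k+1$ contains either a triangle $K_3$ all of whose edges have the same color $i$ for some $i\in\{1,\dots,k\}$, or a copy of $G$ all of whose edges have color $k+1$. *)

(* Defs.v *)
From mathcomp Require Import all_boot.

Set Implicit Arguments.
Unset Strict Implicit.
Unset Printing Implicit Defensive.

Record sgraph := SGraph {
  vertex :> finType;
  adj : rel vertex;
  adj_sym : symmetric adj;
  adj_irr : irreflexive adj }.

Definition edges (G : sgraph) : {set {set G}} :=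
  [set [set p.1; p.2] | p : G * G & adj p.1 p.2].

Definition no_isolated (G : sgraph) : Prop :=
  forall x : G, exists y : G, adj x y.

Lemma neq_sym (T : eqType) : symmetric (fun x y : T => x != y).
Proof. by move=> x y; rewrite eq_sym. Qed.

Lemma neq_irr (T : eqType) : irreflexive (fun x y : T => x != y).
Proof. by move=> x; rewrite eqxx. Qed.

Definition complete_graph (n : nat) : sgraph :=
  @SGraph 'I_n (fun x y => x != y) (@neq_sym _) (@neq_irr _).

(* An edge [x y] of K_N is the set [set x; y]; the values of a coloring on     *)
(* sets that do not have exactly two elements are never used.                 *)
Definition coloring (N q : nat) := {ffun {set 'I_N} -> 'I_q}.

Definition mono_copy (N q : nat) (c : coloring N q) (H : sgraph) (i : 'I_q) :
    bool :=
  [exists f : {ffun H -> 'I_N}, injectiveb f &&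
    [forall u, forall v, adj u v ==> (c [set f u; f v] == i)]].

(* The colors 1, ..., k+1 are the elements 0, ..., k of 'I_k.+1; in           *)
(* particular the color k+1 is ord_max.                                       *)
Definition ramsey_prop (k : nat) (G : sgraph) (N : nat) : bool :=
  [forall c : coloring N k.+1,
    [exists i : 'I_k.+1, (i < k) && mono_copy c (complete_graph 3) i]
    || mono_copy c G ord_max].

Definition bounded_by (k n : nat) (D : {set 'I_k.+1}) (B : nat) : Prop :=
  forall N (c : coloring N k.+1) (A : {set 'I_N}),
    {in A &, forall x y, x != y -> c [set x; y] \in ord_max |: D} ->
    B <= #|A| ->
    (exists i : 'I_k.+1, (i < k) && mono_copy c (complete_graph 3) i)
    \/ exists S : {set 'I_N}, [/\ S \subset A, #|S| = n
         & {in S &, forall x y, x != y -> c [set x; y] = ord_max}].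

Lemma triangleP k N (c : coloring N k.+1) i x y z :
  x != y -> x != z -> y != z -> c [set x; y] = i -> c [set x; z] = i ->
  c [set y; z] = i -> mono_copy c (complete_graph 3) i.
Proof.
move=> nxy nxz nyz cxy cxz cyz; apply/existsP.
exists [ffun u : 'I_3 => nth x [:: x; y; z] u]; apply/andP; split.
  apply/injectiveP => u v; rewrite !ffunE => /eqP.
  rewrite nth_uniq //= ?inE ?negb_or ?nxy ?nxz ?nyz //.
  by move/eqP/val_inj.
apply/forallP => u; apply/forallP => v; apply/implyP; rewrite !ffunE /=.
case: u => [[|[|[|//]]] ?]; case: v => [[|[|[|//]]] ?] //= _; apply/eqP => //;
by rewrite setUC.
Qed.

Lemma ramsey_bound k j n (D : {set 'I_k.+1}) :
  #|D| <= j -> exists B, bounded_by n D B.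
Proof.
elim: j n D => [|j IHj] n D.
  rewrite leqn0 cards_eq0 => /eqP->; exists n => N c A Ac leA; right.
  have [S SA Sn]: exists2 S : {set 'I_N}, S \subset A & #|S| = n.
    exists [set x in take n (enum A)].
      by apply/subsetP => x; rewrite inE => /mem_take; rewrite mem_enum.
    rewrite cardsE (card_uniqP (take_uniq _ (enum_uniq _))) size_takel //.
    by rewrite -cardE.
  exists S; split=> // x y xS yS nxy; apply/set1P.
  by have := Ac x y (subsetP SA x xS) (subsetP SA y yS) nxy; rewrite setU0.
elim: n D => [|n IHn] D leD.
  by exists 0 => N c A _ _; right; exists set0; split;
    rewrite ?sub0set ?cards0 // => x y; rewrite inE.
have [B1 HB1] := IHn D leD.
have [f Hf]: exists f : 'I_k.+1 -> nat,
    forall i, i \in D -> bounded_by n.+1 (D :\ i) (f i).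
  have /fin_all_exists : forall i, exists B,
      i \in D -> bounded_by n.+1 (D :\ i) B.
    move=> i; have [iD|iD] := boolP (i \in D); last by exists 0.
    have [|B HB] := IHj n.+1 (D :\ i); last by exists B.
    by move: leD; rewrite (cardsD1 i) iD.
  by case=> f Hf; exists f.
pose M := (B1 + \sum_i f i).+1.
exists (k.+1 * M).+2 => N c A Ac leA.
have [v vA] : exists v, v \in A by apply/card_gt0P; apply: leq_trans leA.
pose A_ i := [set x in A | (x != v) && (c [set v; x] == i)].
have [i leMi] : exists i, M <= #|A_ i|.
  apply/existsP; apply: contraLR leA; rewrite negb_exists -ltnNge => /forallP h.
  rewrite (cardsD1 v) vA add1n 2!ltnS.
  have -> : #|A :\ v| = \sum_i #|A_ i|.
    rewrite -sum1_card (partition_big (fun x => c [set v; x]) predT) //=.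
    apply: eq_bigr => i _; rewrite -sum1_card; apply: eq_bigl => x.
    by rewrite !inE andbA (andbC (x \in A)).
  rewrite -[X in X * _](card_ord k.+1) -sum_nat_const; apply: leq_sum => i _.
  by apply: ltnW; rewrite ltnNge.
have sAA : A_ i \subset A by apply/subsetP => x; rewrite inE => /andP[].
have A_v x : x \in A_ i -> [/\ x \in A, x != v & c [set v; x] = i].
  by rewrite inE => /and3P[? ? /eqP].
have Aic : {in A_ i &, forall x y, x != y -> c [set x; y] \in ord_max |: D}.
  by move=> x y /(subsetP sAA) xA /(subsetP sAA) yA; apply: Ac.
have [imax|inmax] := eqVneq i ord_max.
  have leB1 : B1 <= #|A_ i|.
    by apply: leq_trans leMi; rewrite /M -addnS leq_addr.
  case: (HB1 N c (A_ i) Aic leB1) => [|[S [SA Sn Sc]]]; first by left.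
  right; exists (v |: S); split.
  - by rewrite subUset sub1set vA (subset_trans SA).
  - rewrite cardsU1 Sn; case: (boolP (v \in S)) => // /(subsetP SA) /A_v[_].
    by rewrite eqxx.
  - move=> x y /setU1P[->|xS] /setU1P[->|yS]; rewrite ?eqxx // => nxy.
    + by case/(subsetP SA)/A_v: yS => _ _ ->.
    + by rewrite setUC; case/(subsetP SA)/A_v: xS => _ _ ->.
    + exact: Sc.
have ltik : i < k by rewrite ltn_neqAle -ltnS ltn_ord andbT; move: inmax.
have iD : i \in D.
  have [x /A_v[xA xv cx]] : exists x, x \in A_ i.
    by apply/card_gt0P; apply: leq_trans leMi.
  have := Ac v x vA xA; rewrite eq_sym cx => /(_ xv).
  by case/setU1P => // E; rewrite E eqxx in inmax.
have [/existsP[p /and4P[pA qA npq /eqP cpq]]|noi] := boolP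
    [exists p : 'I_N * 'I_N, [&& p.1 \in A_ i, p.2 \in A_ i, p.1 != p.2
      & c [set p.1; p.2] == i]].
  left; exists i; rewrite ltik /=.
  case/A_v: pA => _ pv cp; case/A_v: qA => _ qv cq.
  by apply: (@triangleP _ _ _ _ v p.1 p.2) => //; rewrite eq_sym.
case: (Hf i iD N c (A_ i)) => [x y xA yA nxy|||[S [SA Sn Sc]]].
- have := Aic x y xA yA nxy; rewrite !inE => /orP[->//|->]; rewrite andbT.
  apply/orP; right; apply: contra noi => ci.
  by apply/existsP; exists (x, y); rewrite /= xA yA nxy ci.
- apply: leq_trans leMi; rewrite /M -addSn (bigD1 i) //= addnCA.
  exact: leq_addr.
- by left.
- by right; exists S; split=> //; apply: subset_trans SA sAA.
Qed.

Lemma ramsey_exists (k : nat) (G : sgraph) : exists N, (0 < N) && ramsey_prop k G N.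
Proof.
have [B HB] := @ramsey_bound k _ #|G| setT (leqnn _).
exists B.+1; apply/forallP => c.
case: (HB _ c setT) => [x y _ _ _||/existsP->//|[S [_ Sn Sc]]].
- by rewrite !inE orbT.
- by rewrite cardsT card_ord.
apply/orP; right; apply/existsP.
exists [ffun u : G => enum_val (cast_ord (esym Sn) (enum_rank u))].
have finj : injective (fun u : G => enum_val (cast_ord (esym Sn) (enum_rank u))).
  by move=> u v /enum_val_inj/cast_ord_inj/enum_rank_inj.
apply/andP; split.
  by apply/injectiveP => u v; rewrite !ffunE => /finj.
apply/forallP => u; apply/forallP => v; apply/implyP => uv.
rewrite !ffunE; apply/eqP/Sc; try exact: enum_valP.
by rewrite (inj_eq finj); apply: contraTneq uv => ->; rewrite adj_irr.
Qed.

(* r_{k+1}(K_3; G) *)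
Definition ramsey (k : nat) (G : sgraph) : nat := ex_minn (ramsey_exists k G).

(* Main.v *)
(** Let [A] be a set of vertices on which only [j] of the triangle-free colors
    and the last color ("blue") occur, and embed [G] greedily in blue, the
    vertex [v] of least degree in the current vertex set [S] being placed last.
    This is possible unless some vertex of [A] has a large non-blue
    neighborhood in [A].  The neighborhood in one triangle-free color does not
    contain this color any more, so in that case one concludes by induction on
    [j].  The degree [d] of [v] in [S] satisfies [d * #|S| <= 2m], hence
    [d <= sqrt (2m)] and each color costs a factor of order [sqrt m]; for
    [j = 1], where the neighborhood is a blue clique and need only have
    [#|S|] elements, the bound [d * #|S| <= 2m] gives a linear estimate. *)

Require Import Defs.
From mathcomp Require Import all_boot.
From mathcomp Require Import zify.

Lemma leq_card_bigcup (I T : finType) (P : pred I) (F : I -> {set T}) :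
  (#|\bigcup_(i | P i) F i| <= \sum_(i | P i) #|F i|)%N.
Proof.
elim/big_rec2: _ => [|i n U _ leUn]; first by rewrite cards0.
by rewrite (leq_trans (leq_card_setU _ _).1) ?leq_add2l.
Qed.

(** * Degree sums and edge counts *)

Section Degrees.
Local Open Scope nat_scope.
Variable G : sgraph.
Implicit Types S : {set G}.

Definition degree_in S (v : G) := #|[set u in S | adj v u]|.

(** Ordered adjacent pairs are grouped by the edge they span; a fibre contains at most the two
    orderings of its edge. *)
Lemma sum_degree_le_edges : \sum_(v : G) #|[set u | adj v u]| <= 2 * #|edges G|.
Proof.
pose h (p : G * G) := [set p.1; p.2].
have -> : \sum_(v : G) #|[set u | adj v u]|
    = \sum_(p in [set p : G * G | adj p.1 p.2]) 1.
  under eq_bigr do rewrite -sum1_card.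
  rewrite pair_big_dep /=; apply: eq_bigl => -[u v].
  by rewrite !inE.
rewrite (partition_big_imset h) /= mulnC -sum_nat_const.
have -> : edges G = h @: [set p : G * G | adj p.1 p.2].
  by apply/setP => e; apply/imsetP/imsetP => -[p]; rewrite inE => pe ->;
    exists p; rewrite ?inE.
apply: leq_sum => _ /imsetP[[a b] _ ->].
rewrite sum1_card; apply: (@leq_trans #|[set (a, b); (b, a)]|); last first.
  by rewrite cards2; case: eqP.
apply/subset_leq_card/subsetP => -[x y].
rewrite unfold_in /= inE /h /= => /andP[xy /eqP e].
have nxy : x != y by apply: contraTneq xy => ->; rewrite adj_irr.
have : x \in [set a; b] by rewrite -e !inE eqxx.
have : y \in [set a; b] by rewrite -e !inE eqxx orbT.
rewrite !inE !xpair_eqE => /orP[] /eqP ey /orP[] /eqP ex;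
  by move: nxy; rewrite ex ey !eqxx ?orbT.
Qed.

(** A minimum is at most the average, and degrees inside [S] are at most degrees in [G]. *)
Lemma min_degree_in S : S != set0 ->
  exists2 v, v \in S & degree_in S v * #|S| <= 2 * #|edges G|.
Proof.
case/set0Pn => v0 v0S.
pose v := [arg min_(v < v0 | v \in S) degree_in S v].
exists v; first by rewrite /v; case: arg_minnP.
apply: leq_trans sum_degree_le_edges; rewrite mulnC -sum_nat_const.
apply: (@leq_trans (\sum_(u in S) degree_in S u)).
  by apply: leq_sum => u uS; rewrite /v; case: arg_minnP => // w _; apply.
rewrite [leqRHS](bigID (mem S)) /=; apply: leq_trans (leq_addr _ _).
apply: leq_sum => u _; apply/subset_leq_card/subsetP => w.
by rewrite !inE => /andP[].
Qed.

Lemma card_le_edges : no_isolated G -> #|G| <= 2 * #|edges G|.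
Proof.
move=> iso; apply: leq_trans sum_degree_le_edges; rewrite -sum1_card.
apply: leq_sum => v _; have [u vu] := iso v.
by apply/card_gt0P; exists u; rewrite inE.
Qed.

Lemma degree_in_le_card S v : degree_in S v <= #|S|.
Proof. by apply/subset_leq_card/subsetP => u; rewrite inE => /andP[]. Qed.

End Degrees.

Arguments degree_in {G} S v.

(** * Greedy embedding in the last color *)

Section Embedding.
Local Open Scope nat_scope.
Variables (G : sgraph) (k N : nat) (c : coloring N k.+1).
Implicit Types (A B : {set 'I_N}) (S : {set G}) (D : {set 'I_k.+1}).

(** The map is total on [G] and constrained only on [S], so [S] can shrink in an induction while the
    type of [f] stays fixed. *)
Definition embeds A S := exists f : G -> 'I_N,
  [/\ {in S &, injective f}, {in S, forall u, f u \in A}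
    & {in S &, forall u v, adj u v -> c [set f u; f v] = ord_max}].

Definition off_nbhd A x := [set y in A | (y != x) && (c [set x; y] != ord_max)].

Definition color_nbhd A x i := [set y in A | (y != x) && (c [set x; y] == i)].

Definition colored_in A D :=
  {in A &, forall x y, x != y -> c [set x; y] \in ord_max |: D}.

Lemma embeds_subset A B S : A \subset B -> embeds A S -> embeds B S.
Proof.
move=> /subsetP sAB [f [fi fA fc]].
by exists f; split=> // u uS; apply/sAB/fA.
Qed.

(** Once [S :\ v] is embedded, at most [#|S| - 1 + degree_in S v * d S] vertices of [A] are
    forbidden for [v], which is less than [#|A|]. The threshold [d] may vary with [S], as the case
    of a single color requires. *)
Lemma greedy_embedding A (d : {set G} -> nat) :
  0 < #|A| ->
  (forall S, S != set0 ->
     exists2 v, v \in S & degree_in S v * d S + #|S| <= #|A|) ->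
  (forall S x, x \in A -> d S < #|off_nbhd A x| -> embeds A S) ->
  forall S, embeds A S.
Proof.
move=> /card_gt0P[x0 x0A] hdeg hoff S.
have [n] := ubnP #|S|; elim: n S => // n IHn S; rewrite ltnS => leSn.
have [->|S0] := eqVneq S set0.
  by exists (fun=> x0); split=> // u; rewrite inE.
have [v vS hv] := hdeg S S0.
have cS : #|S| = #|S :\ v|.+1 by rewrite (cardsD1 v) vS.
have [|f [fi fA fc]] := IHn (S :\ v); first by rewrite -cS.
(* A vertex with a large off-color neighborhood yields the embedding directly; otherwise all of them
   are small. *)
have [x /andP[xA /hoff]|none] := pickP [pred x in A | d S < #|off_nbhd A x|].
  exact.
have small x : x \in A -> #|off_nbhd A x| <= d S.
  by move=> xA; have := none x; rewrite /= xA /= => lt; rewrite leqNgt lt.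
pose nb := [set u in S | adj v u].
(* Avoiding the first part keeps the map injective; avoiding the second gives color [ord_max] to the
   edges at [v]. *)
pose bad := f @: (S :\ v) :|: \bigcup_(u in nb) off_nbhd A (f u).
have nbS u : u \in nb -> u \in S :\ v.
  rewrite !inE => /andP[-> vu]; rewrite andbT.
  by apply: contraTneq vu => ->; rewrite adj_irr.
have cbad : #|bad| < #|A|.
  apply: leq_trans hv; rewrite cS addnS ltnS addnC.
  apply: leq_trans (leq_card_setU _ _).1 _; apply: leq_add.
    exact: leq_imset_card.
  apply: leq_trans (leq_card_bigcup _ _ _ _) _.
  rewrite /degree_in -sum_nat_const; apply: leq_sum => u /nbS uS.
  by rewrite small ?fA.
have [y yA ybad] : exists2 y, y \in A & y \notin bad.
  apply/subsetPn; apply: contraTN cbad => /subset_leq_card.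
  by rewrite -leqNgt.
move: ybad; rewrite in_setU negb_or => /andP[yim ynb].
have yf u : u \in S -> u != v -> y != f u.
  move=> uS uv; apply: contraNneq yim => ->; apply: imset_f.
  by rewrite !inE uv uS.
have yc u : u \in S -> adj v u -> c [set f u; y] = ord_max.
  move=> uS vu; have un : u \in nb by rewrite inE uS vu.
  have uv : u != v by have := nbS u un; rewrite !inE => /andP[].
  apply/eqP; apply: contraNT ynb => nc; apply/bigcupP; exists u => //.
  by rewrite inE yA yf.
exists (fun u => if u == v then y else f u); split.
- move=> u w uS wS; case: eqVneq => [->|uv]; case: eqVneq => [->|wv] //.
  + by move/eqP; rewrite (negPf (yf _ _ _)).
  + by move/esym/eqP; rewrite (negPf (yf _ _ _)).
  + by apply: fi; rewrite !inE ?uv ?wv ?uS ?wS.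
- by move=> u uS; case: eqVneq => // uv; apply: fA; rewrite !inE uv.
- move=> u w uS wS; case: eqVneq => [->|uv]; case: eqVneq => [->|wv].
  + by rewrite adj_irr.
  + by move=> vw; rewrite setUC yc.
  + by rewrite adj_sym => vu; rewrite yc.
  + by apply: fc; rewrite !inE ?uv ?wv ?uS ?wS.
Qed.

Lemma clique_embeds A S : colored_in A set0 -> 0 < #|A| -> #|S| <= #|A| ->
  embeds A S.
Proof.
move=> Ac A0 leSA; have [x0 x0A] := card_gt0P A0.
pose f u := nth x0 (enum A) (index u (enum S)).
have lt u : u \in S -> index u (enum S) < size (enum A).
  move=> uS; rewrite -cardE; apply: leq_trans leSA.
  by rewrite cardE index_mem mem_enum.
have fi : {in S &, injective f}.
  move=> u v uS vS /eqP; rewrite nth_uniq ?lt ?enum_uniq // => /eqP e.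
  by rewrite -[u](nth_index u (s := enum S)) ?mem_enum // e nth_index ?mem_enum.
have fA : {in S, forall u, f u \in A}.
  by move=> u uS; rewrite -mem_enum mem_nth ?lt.
exists f; split=> // u v uS vS uv.
apply/set1P; rewrite -[[set ord_max]]setU0; apply: Ac; rewrite ?fA //.
by apply: contraTneq uv => /fi->//; rewrite adj_irr.
Qed.

(** * Induction on the number of triangle-free colors *)

Hypothesis no_triangle :
  forall i : 'I_k.+1, i < k -> ~~ mono_copy c (complete_graph 3) i.

(** An edge of color [i] inside the neighborhood would close a triangle of color [i] with [x]. *)
Lemma color_nbhd_colored A D x i : i != ord_max -> colored_in A D ->
  colored_in (color_nbhd A x i) (D :\ i).
Proof.
move=> imax Ac y z; rewrite !inE => /and3P[yA yx /eqP cy] /and3P[zA zx /eqP cz].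
move=> yz; have := Ac y z yA zA yz; rewrite !inE => /orP[->//|->].
rewrite andbT; apply/orP; right.
have ltik : i < k by rewrite ltn_neqAle -ltnS ltn_ord andbT; move: imax.
apply: contraNneq (no_triangle _ ltik) => cyz.
by apply: (@triangleP _ _ _ _ x y z) => //; rewrite eq_sym.
Qed.

Lemma off_nbhd_color A D x : x \in A -> colored_in A D ->
  off_nbhd A x \subset \bigcup_(i in D) color_nbhd A x i.
Proof.
move=> xA Ac; apply/subsetP => y; rewrite inE => /and3P[yA yx cmax].
apply/bigcupP; exists (c [set x; y]); last by rewrite inE yA yx eqxx.
have := Ac x y xA yA; rewrite eq_sym => /(_ yx).
by case/setU1P => // e; rewrite e eqxx in cmax.
Qed.

(** Pigeonhole over the colors in [D], whose neighborhoods cover the off-color one. *)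
Lemma large_color_nbhd A D x b : x \in A -> colored_in A D ->
  #|D| * b < #|off_nbhd A x| -> exists2 i, i \in D & b < #|color_nbhd A x i|.
Proof.
move=> xA Ac lt; have [i /andP[iD ltb]|none] :=
  pickP [pred i in D | b < #|color_nbhd A x i|]; first by exists i.
move: lt; rewrite ltnNge => /negP[].
apply: leq_trans (subset_leq_card (off_nbhd_color A D x xA Ac)) _.
apply: leq_trans (leq_card_bigcup _ _ _ _) _.
by rewrite -sum_nat_const; apply: leq_sum => i iD; have := none i;
  rewrite /= iD /= => lt; rewrite leqNgt lt.
Qed.

(* With [s = floor (sqrt (2m))], the bound [b_j = color_const j * s ^ j.+1] must
   satisfy [2m + #|G| <= b_1] and [s * (j.+1 * b_j) + #|G| <= b_(j.+1)], where
   [#|G| <= 2m <= 4 * s ^ 2].  The value at [0] is junk. *)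
Fixpoint color_const j :=
  if j is j'.+1 then if j' is 0 then 8 else j * color_const j' + 4 else 0.

Lemma color_const_gt0 j : 0 < color_const j.+1.
Proof. by case: j => //= j; rewrite addn4. Qed.

Lemma embedding_bound s :
  no_isolated G -> 0 < s -> s ^ 2 <= 2 * #|edges G| < s.+1 ^ 2 ->
  forall j A D S, #|D| = j.+1 -> ord_max \notin D -> colored_in A D ->
    color_const j.+1 * s ^ j.+2 <= #|A| -> embeds A S.
Proof.
move=> iso s0 /andP[s2m ms]; have nm := card_le_edges G iso.
(* Since [s >= 1], [s.+1 <= 2 * s]. *)
have m4 : 2 * #|edges G| <= 4 * s ^ 2.
  by apply: ltnW; apply: leq_trans ms _; rewrite -!mulnn; nia.
have cardG S : #|S| <= 4 * s ^ 2.
  by apply: leq_trans m4; apply: leq_trans nm; apply: max_card.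
elim=> [|j IHj] A D S cD maxD Ac leA.
  have A0 : 0 < #|A| by apply: leq_trans leA; rewrite muln_gt0 expn_gt0 s0.
  (* With threshold [#|S|], both the degree term and [#|S|] are at most [4 * s ^ 2], whence the
     constant 8. *)
  apply: (@greedy_embedding A (fun S => #|S|)) => // {}S.
    move=> /min_degree_in[v vS hv]; exists v => //; apply: leq_trans leA.
    by rewrite /= -[8]/(4 + 4) mulnDl leq_add // (leq_trans hv).
  move=> x xA lt; have [|i iD ltS] := large_color_nbhd A D x #|S| xA Ac.
    by rewrite cD mul1n.
  apply: (@embeds_subset (color_nbhd A x i)).
    by apply/subsetP => y; rewrite inE => /andP[].
  apply: clique_embeds; [|exact: leq_trans ltS|exact: ltnW].
  (* The only triangle-free color is used up, so the neighborhood is a clique in the last color. *)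
  have <- : D :\ i = set0.
    apply/eqP; rewrite -cards_eq0; move: cD.
    by rewrite (cardsD1 i) iD add1n => -[->].
  by apply: color_nbhd_colored Ac; apply: contraNneq maxD => <-.
pose b := color_const j.+1 * s ^ j.+2.
have A0 : 0 < #|A|.
  by apply: leq_trans leA; rewrite muln_gt0 expn_gt0 s0 color_const_gt0.
(* More than [j.+2 * b] off-color neighbors, spread over [j.+2] colors, put more than [b] in one
   color. *)
apply: (@greedy_embedding A (fun=> j.+2 * b)) => // {}S.
  move=> /min_degree_in[v vS hv]; exists v => //; apply: leq_trans leA.
  (* As [degree_in S v <= #|S|], the square of the degree is at most [2m < s.+1 ^ 2]. *)
  have ds : degree_in S v <= s.
    rewrite -ltnS -ltn_sqr; apply: leq_ltn_trans ms; apply: leq_trans hv.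
    by rewrite -mulnn leq_mul2l degree_in_le_card orbT.
  rewrite [color_const _]/(j.+2 * color_const j.+1 + 4) mulnDl leq_add //.
    apply: (@leq_trans (s * (j.+2 * b))); first by rewrite leq_mul2r ds orbT.
    by rewrite /b [s ^ j.+3]expnS; lia.
  by apply: leq_trans (cardG S) _; rewrite leq_mul2l leq_pexp2l.
move=> x xA lt; have [|i iD ltS] := large_color_nbhd A D x b xA Ac.
  by rewrite cD.
apply: (@embeds_subset (color_nbhd A x i)).
  by apply/subsetP => y; rewrite inE => /andP[].
apply: (IHj _ (D :\ i)); last exact: ltnW.
- by move: cD; rewrite (cardsD1 i) iD add1n => -[->].
- by rewrite !inE (negPf maxD) andbF.
- by apply: color_nbhd_colored Ac; apply: contraNneq maxD => <-.
Qed.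

End Embedding.

(** * From embeddings to the Ramsey number *)

Lemma ramsey_le (k s : nat) (G : sgraph) : no_isolated G -> (0 < s)%N ->
  (s ^ 2 <= 2 * #|edges G| < s.+1 ^ 2)%N ->
  (ramsey k.+1 G <= color_const k.+1 * s ^ k.+2)%N.
Proof.
move=> iso s0 hs; rewrite /ramsey; case: ex_minnP => n _ min_n; apply: min_n.
rewrite muln_gt0 expn_gt0 s0 color_const_gt0 /=; apply/forallP => c.
apply/orP; case: existsP => [?|notri]; [by left|right].
have {}notri (i : 'I_k.+2) : (i < k.+1)%N ->
    ~~ mono_copy c (complete_graph 3) i.
  by move=> ik; apply/negP => ci; apply: notri; exists i; rewrite ik.
(* Take all vertices as [A], all of [G] as [S], and every color but the last as [D]. *)
have [||||f [fi _ fc]] := @embedding_bound G _ _ c notri s iso s0 hs k setT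
  (~: [set ord_max]) setT.
- by rewrite cardsC1 card_ord.
- by rewrite !inE eqxx.
- by move=> x y _ _ _; rewrite !inE orbN.
- by rewrite cardsT card_ord.
apply/existsP; exists (finfun f); apply/andP; split.
  by apply/injectiveP => u v; rewrite !ffunE => /fi->; rewrite ?inE.
apply/forallP => u; apply/forallP => v; apply/implyP => uv.
by rewrite !ffunE fc ?inE.
Qed.

Lemma isqrt_exists (n : nat) : exists s : nat, (s ^ 2 <= n < s.+1 ^ 2)%N.
Proof.
elim: n => [|n [s /andP[le lt]]]; first by exists 0%N.
have [lt'|le'] := ltnP n.+1 (s.+1 ^ 2)%N.
  by exists s; rewrite lt' (leq_trans le).
exists s.+1; rewrite le' /=; move: lt le'; rewrite -!mulnn; nia.
Qed.

(* Passage to real exponents *)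
From mathcomp Require Import all_order all_algebra.
From mathcomp Require Import all_classical all_reals all_analysis.

Import Order.TTheory GRing.Theory Num.Theory.

Local Open Scope ring_scope.

Theorem theorem4 (R : realType) (k : nat) (hk : (1 <= k)%N) :
  exists c : R, forall G : sgraph,
    (0 < #|G|)%N -> no_isolated G ->
    (ramsey k G)%:R <= c * (#|edges G|%:R `^ (k.+1%:R / 2)).
Proof.
case: k hk => // k _.
(* The power of 2 comes from [s ^ k.+2 = (s ^ 2) ^ (k.+2 / 2) <= (2m) ^ (k.+2 / 2)]. *)
exists ((color_const k.+1)%:R * 2 `^ (k.+2%:R / 2)) => G G0 iso.
have m0 : (0 < 2 * #|edges G|)%N by apply: leq_trans (card_le_edges G iso).
have [s hs] := isqrt_exists (2 * #|edges G|).
have s0 : (0 < s)%N by case: s hs => // /andP[_]; rewrite ltnNge m0.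
apply: le_trans (_ : (color_const k.+1 * s ^ k.+2)%N%:R <= _).
  by rewrite ler_nat ramsey_le.
rewrite natrM -mulrA ler_wpM2l // -powRM // -natrM.
have -> : (s ^ k.+2)%N%:R = ((s ^ 2)%N%:R : R) `^ (k.+2%:R / 2).
  rewrite !natrX -!powR_mulrn // -powRrM; congr (_ `^ _).
  by rewrite mulrC divfK // pnatr_eq0.
apply: ge0_ler_powR; rewrite ?nnegrE ?ler0n ?divr_ge0 //.
by rewrite ler_nat; case/andP: hs.
Qed.
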